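(* Let $a \in (0,1)$ and define $$\mathcal{N}(a) = \frac{20800}{a^7(1-a)^4}.$$ Let $n$ be an integer with $n \geq \mathcal{N}(a)$, and let $P(z) = (z-a)\prod_{j=1}^{n-1}(z-z_j)$ be a polynomial with $z_1,\dots,z_{n-1}\in\mathbb{C}$ and $|z_j|\leq 1$ for all $j = 1, \ldots , n-1$. Then the closed disk $\{z\in\mathbb{C} : |z-a|\leq 1\}$ contains a critical point of $P$ (i.e. a zero of $P'$). *)

(* Defs.v *)
From HB Require Import structures.
From mathcomp Require Import all_boot all_order all_algebra.
Set Implicit Arguments. Unset Strict Implicit. Unset Printing Implicit Defensive.
Import Order.TTheory GRing.Theory Num.Theory.
Local Open Scope ring_scope.

Definition calN (C : numClosedFieldType) (a : C) : C :=
  20800%:R / (a ^+ 7 * (1 - a) ^+ 4).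

Definition sendovP (C : numClosedFieldType) (a : C) (n : nat)
  (z : 'I_n.-1 -> C) : {poly C} :=
  ('X - a%:P) * \prod_(j < n.-1) ('X - (z j)%:P).

(* Main.v *)
Require Import Defs.
From HB Require Import structures.
From mathcomp Require Import all_boot all_order all_algebra.
From mathcomp Require Import ring lra.
Import Order.TTheory GRing.Theory Num.Theory.
Local Open Scope ring_scope.
Set Implicit Arguments. Unset Strict Implicit. Unset Printing Implicit Defensive.

(** Let [P = (z - a) p] have degree [n], and suppose that every critical point [g] of [P]
satisfies [|g - a| > 1].  By Gauss-Lucas, [g] lies in the lune [|g| <= 1 < |g - a|], on
which [Re (1 / (a - g)) >= a / 2].  Grace's theorem, applied to the functional "integral
of [P'] between two points", evaluates [p] exactly:
[p c = (P' a / n) (1 + u + ... + u^(n-1))], where [|u| < 1] is the ratio of the distances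
from some point of an Apollonius disk containing all [g] to [c] and to [a].
With [L := |P' a / n| >= 1], this has four consequences.
- [|p c| >= L / 4] for real [c] in [0, a] not too close to the endpoints; taking
  [c] of order [1 / (n a)] shows that the product of the [1 / |z_j|] (cut off at
  [|z_j| = 1/2]) is bounded independently of [n].
- [p] has no zero near [a - e / 2], where [|p|] is at most a constant times [L].
- [|p (a + e)| >= (L / 4) (1 + e a)^((n - 1) / 2)] grows exponentially in [n].
- [|p (a - 2 e)| >= L / 4].
Compare with [q x = prod (1 - z_j^* x)], which dominates [|p|] on [0, 1].  The points
[a - 2 e], [a - e / 2], [a + e] are in arithmetic progression and [log |q|] is harmonic
in the unit disk, so
[|q (a + e) q (a - 2 e)| <= |q (a - e / 2)|^2 (1 + O(e^2 / (1 - a)^2))^n], while the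
first two consequences bound [|q (a - e / 2)| / L] independently of [n].  For
[e = a (1 - a)^2 / 9] and [n] large this contradicts the exponential growth. *)

(** * Real elements of a closed numeric field *)

Definition creal (C : numClosedFieldType) := {x : C | x \is Num.real}.

Section RealSubfield.
Variable C : numClosedFieldType.
Local Notation R := (creal C).

HB.instance Definition _ := SubChoice.on R.
HB.instance Definition _ := [SubChoice_isSubIntegralDomain of R by <:].
HB.instance Definition _ := [SubIntegralDomain_isSubField of R by <:].

Let rle (x y : R) := val x <= val y.
Let rlt (x y : R) := val x < val y.
Let rnorm (x : R) : R := Sub `|val x| (normr_real (val x)).

Fact rle0_add x y : rle 0 x -> rle 0 y -> rle 0 (x + y).
Proof. exact: addr_ge0. Qed.
Fact rle0_mul x y : rle 0 x -> rle 0 y -> rle 0 (x * y).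
Proof. exact: mulr_ge0. Qed.
Fact rle0_anti x : rle 0 x -> rle x 0 -> x = 0.
Proof. by move=> x0 x0'; apply/val_inj/le_anti/andP. Qed.
Fact rsub_ge0 x y : rle 0 (y - x) = rle x y.
Proof. exact: subr_ge0. Qed.
Fact rle0_total x : rle 0 x || rle x 0.
Proof. by have := valP x; rewrite realE. Qed.
Fact rnormN x : rnorm (- x) = rnorm x.
Proof. by apply/val_inj; exact: normrN. Qed.
Fact rge0_norm x : rle 0 x -> rnorm x = x.
Proof. by move=> x0; apply/val_inj; exact: ger0_norm. Qed.
Fact rlt_def x y : rlt x y = (y != x) && rle x y.
Proof. exact: lt_def. Qed.

HB.instance Definition _ := Num.IntegralDomain_isLeReal.Build R
  rle0_add rle0_mul rle0_anti rsub_ge0 rle0_total rnormN rge0_norm rlt_def.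

Definition of_creal : R -> C := val.
HB.instance Definition _ := GRing.RMorphism.on of_creal.

End RealSubfield.

Notation "x %:C" := (of_creal x) (at level 2, left associativity, format "x %:C").

Section Coordinates.
Variable C : numClosedFieldType.
Local Notation R := (creal C).
Implicit Types (x y : C) (r t : R).

Lemma of_creal_inj : injective (@of_creal C). Proof. exact: val_inj. Qed.
Lemma ler_of_creal : {mono @of_creal C : r t / r <= t}. Proof. by []. Qed.

Definition re x : R := Sub ('Re x) (Creal_Re x).
Definition im x : R := Sub ('Im x) (Creal_Im x).
Definition nrm x : R := Sub `|x| (normr_real x).

Lemma of_creal_re x : (re x)%:C = 'Re x. Proof. by []. Qed.
Lemma of_creal_im x : (im x)%:C = 'Im x. Proof. by []. Qed.
Lemma of_creal_nrm x : (nrm x)%:C = `|x|. Proof. by []. Qed.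

Fact re_is_zmod_morphism : zmod_morphism re.
Proof. by move=> x y; apply: of_creal_inj; rewrite rmorphB /= !of_creal_re raddfB. Qed.
Fact im_is_zmod_morphism : zmod_morphism im.
Proof. by move=> x y; apply: of_creal_inj; rewrite rmorphB /= !of_creal_im raddfB. Qed.
HB.instance Definition _ := GRing.isZmodMorphism.Build C R re re_is_zmod_morphism.
HB.instance Definition _ := GRing.isZmodMorphism.Build C R im im_is_zmod_morphism.

Lemma reD x y : re (x + y) = re x + re y. Proof. exact: raddfD. Qed.
Lemma imD x y : im (x + y) = im x + im y. Proof. exact: raddfD. Qed.
Lemma reN x : re (- x) = - re x. Proof. exact: raddfN. Qed.
Lemma imN x : im (- x) = - im x. Proof. exact: raddfN. Qed.

Lemma reM x y : re (x * y) = re x * re y - im x * im y.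
Proof.
by apply: of_creal_inj; rewrite rmorphB !rmorphM /= !(of_creal_re, of_creal_im) ReM.
Qed.

Lemma imM x y : im (x * y) = re x * im y + re y * im x.
Proof.
by apply: of_creal_inj; rewrite rmorphD !rmorphM /= !(of_creal_re, of_creal_im) ImM.
Qed.

Lemma re_conj x : re x^* = re x.
Proof. by apply: of_creal_inj; rewrite of_creal_re Re_conj. Qed.
Lemma im_conj x : im x^* = - im x.
Proof. by apply: of_creal_inj; rewrite rmorphN /= !of_creal_im Im_conj. Qed.

Lemma re_of_creal r : re r%:C = r.
Proof. by apply: of_creal_inj; rewrite of_creal_re; apply/Creal_ReP/(valP r). Qed.
Lemma im_of_creal r : im r%:C = 0.
Proof. by apply: of_creal_inj; rewrite of_creal_im rmorph0; apply/Creal_ImP/(valP r). Qed.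

Lemma re1 : re 1 = 1. Proof. by rewrite -(rmorph1 (@of_creal C)) re_of_creal. Qed.
Lemma im1 : im 1 = 0. Proof. by rewrite -(rmorph1 (@of_creal C)) im_of_creal. Qed.

Definition coordE := (reD, imD, reN, imN, reM, imM, re_conj, im_conj,
  re_of_creal, im_of_creal, re1, im1).

Lemma nrm_ge0 x : 0 <= nrm x.
Proof. by rewrite -ler_of_creal rmorph0 of_creal_nrm. Qed.
Lemma nrm_eq0 x : (nrm x == 0) = (x == 0).
Proof. by rewrite -(inj_eq of_creal_inj) of_creal_nrm rmorph0 normr_eq0. Qed.
Lemma nrm0 : nrm 0 = 0. Proof. by apply/eqP; rewrite nrm_eq0. Qed.
Lemma nrm_gt0 x : (0 < nrm x) = (x != 0).
Proof. by rewrite lt0r nrm_eq0 nrm_ge0 andbT. Qed.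
Lemma nrm1 : nrm 1 = 1.
Proof. by apply: of_creal_inj; rewrite of_creal_nrm normr1 rmorph1. Qed.
Lemma nrmN x : nrm (- x) = nrm x.
Proof. by apply: of_creal_inj; rewrite !of_creal_nrm normrN. Qed.
Lemma nrmM x y : nrm (x * y) = nrm x * nrm y.
Proof. by apply: of_creal_inj; rewrite rmorphM /= !of_creal_nrm normrM. Qed.
Lemma nrmV x : nrm x^-1 = (nrm x)^-1.
Proof. by apply: of_creal_inj; rewrite fmorphV /= !of_creal_nrm normfV. Qed.
Lemma nrmX x k : nrm (x ^+ k) = nrm x ^+ k.
Proof. by apply: of_creal_inj; rewrite rmorphXn /= !of_creal_nrm normrX. Qed.
Lemma nrm_prod (I : Type) (r : seq I) (F : I -> C) :
  nrm (\prod_(i <- r) F i) = \prod_(i <- r) nrm (F i).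
Proof. exact: (big_morph nrm nrmM nrm1). Qed.
Lemma nrm_conj x : nrm x^* = nrm x.
Proof. by apply: of_creal_inj; rewrite !of_creal_nrm norm_conjC. Qed.
Lemma nrm_of_creal r : 0 <= r -> nrm r%:C = r.
Proof.
by rewrite -ler_of_creal rmorph0 => r0; apply: of_creal_inj; rewrite of_creal_nrm ger0_norm.
Qed.
Lemma nrmBC x y : nrm (x - y) = nrm (y - x). Proof. by rewrite -nrmN opprB. Qed.
Lemma nrmD_le x y : nrm (x + y) <= nrm x + nrm y.
Proof. by rewrite -ler_of_creal rmorphD /= !of_creal_nrm ler_normD. Qed.
Lemma nrmB_ge x y : nrm x - nrm y <= nrm (x - y).
Proof. by rewrite lerBlDr -{1}(subrK y x) nrmD_le. Qed.

Lemma sqr_nrm x : nrm x ^+ 2 = re x ^+ 2 + im x ^+ 2.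
Proof.
apply: of_creal_inj.
by rewrite rmorphD !rmorphXn /= of_creal_re of_creal_im of_creal_nrm normC2_Re_Im.
Qed.

Lemma sqr_nrmD_real x r : nrm (x + r%:C) ^+ 2 = nrm x ^+ 2 + 2 * r * re x + r ^+ 2.
Proof. by rewrite !sqr_nrm !coordE; ring. Qed.

End Coordinates.

(** * Real inequalities *)

Section Bernoulli.
Variable R : realFieldType.
Implicit Types x y : R.

Lemma bernoulli x n : -1 <= x -> 1 + n%:R * x <= (1 + x) ^+ n.
Proof.
move=> x1; elim: n => [|n IHn]; first by rewrite mul0r addr0 expr0.
rewrite exprS -natr1.
apply: le_trans (_ : (1 + x) * (1 + n%:R * x) <= _); last by rewrite ler_wpM2l //; lra.
by have : 0 <= n%:R * x ^+ 2 by [rewrite mulr_ge0 ?sqr_ge0]; lra.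
Qed.

Lemma expr_1B_le_half x n : 0 <= x <= 1 -> 1 <= n%:R * x -> (1 - x) ^+ n <= 1 / 2.
Proof.
move=> /andP[x0 x1] nx; have pow_1D : 1 + n%:R * x <= (1 + x) ^+ n by apply: bernoulli; lra.
have : ((1 - x) * (1 + x)) ^+ n <= 1 by rewrite exprn_ile1 //; nra.
have : 0 <= (1 - x) ^+ n by rewrite exprn_ge0 //; lra.
by rewrite exprMn; nra.
Qed.

Lemma expr_1D_le4 x n : 0 <= x -> n%:R * x <= 1 -> (1 + x) ^+ n <= 4.
Proof.
case: n => [|n] x0 nx; first by rewrite expr0; lra.
have x1 : x <= 1 by apply: le_trans nx; rewrite ler_peMl // ler1n.
have lower : 1 / 2 <= (1 - x / 2) ^+ n.+1.
  by apply: le_trans (bernoulli _ _); lra.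
have : ((1 + x) * (1 - x / 2) ^+ 2) ^+ n.+1 <= 1.
  have x2 : 0 <= x ^+ 2 * (3 / 4 - x / 4) by rewrite mulr_ge0 ?sqr_ge0 //; lra.
  rewrite exprn_ile1 //; last by lra.
  by rewrite mulr_ge0 ?sqr_ge0 //; lra.
rewrite exprMn exprAC; move: ((1 - x / 2) ^+ n.+1) lower => y y_ge prod_le1.
have pow0 : 0 <= (1 + x) ^+ n.+1 by rewrite exprn_ge0 //; lra.
have : (1 + x) ^+ n.+1 * (1 / 4) <= (1 + x) ^+ n.+1 * y ^+ 2 by rewrite ler_wpM2l //; nra.
lra.
Qed.

(* The field need not be archimedean, hence the explicit multiplier [N]. *)
Lemma ex_natmul_between x y N : 0 < x -> 0 <= y -> y <= N%:R * x ->
  exists K : nat, y <= K%:R * x <= y + x.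
Proof.
move=> x0 y0 yN; have exK : exists K, y <= K%:R * x by exists N.
case: (ex_minnP exK) => K yK minK; exists K; rewrite yK /=.
case: K minK {yK} => [|K] minK; first by rewrite mul0r addr_ge0 // ltW.
rewrite -natr1 mulrDl mul1r lerD2r ltW // ltNge.
by apply/negP => /minK; rewrite ltnn.
Qed.

Lemma ler_16X4_2X k : (23 <= k)%N -> 16 * k.+1%:R ^+ 4 <= 2 ^+ k :> R.
Proof.
move=> /subnKC <-; elim: (k - 23)%N => [|j IHj]; first by rewrite addn0; lra.
rewrite addnS [leRHS]exprS; set x : R := (23 + j).+1%:R in IHj *.
have x24 : 24 <= x by rewrite /x -addSn natrD lerDl.
have : (x + 1) ^+ 4 <= (25 / 24 * x) ^+ 4 by rewrite lerXn2r // ?nnegrE; lra.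
have : 0 <= x ^+ 4 by rewrite exprn_ge0 //; lra.
by rewrite -natr1 -/x; lra.
Qed.

End Bernoulli.

Section Exponents.
Variables (R : realFieldType) (a : R).
Hypotheses (a_gt0 : 0 < a) (a_lt1 : a < 1).
Local Notation u := (a * (1 - a)).

Let b_gt0 : 0 < 1 - a. Proof. by rewrite subr_gt0. Qed.
Let u_gt0 : 0 < u. Proof. by rewrite mulr_gt0. Qed.
Let u_le4 : u <= 1 / 4. Proof. by have := sqr_ge0 (a - 1 / 2); lra. Qed.
Let uX_le1 i : u ^+ i <= 1.
Proof. by rewrite exprn_ile1 ?(ltW u_gt0) //; move: u_le4; lra. Qed.

Lemma dyadic_exponent_le k : 2 ^+ k * u ^+ 4 < 144 ^+ 2 -> k.+1%:R * (a ^+ 4 * (1 - a)) <= 6.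
Proof.
move=> ltk; set t := a ^+ 4 * (1 - a).
have t0 : 0 <= t by rewrite mulr_ge0 ?exprn_ge0 // ltW.
have tu : t <= u.
  by rewrite ler_wpM2r ?(ltW b_gt0) // exprS ger_pMr // exprn_ile1 // ltW.
have [k_lt23|k_ge23] := ltnP k 23.
  apply: (@le_trans _ _ (23 * (1 / 4))); last by lra.
  by rewrite ler_pM // ?(ler_nat R _ 23) //; apply: le_trans u_le4.
rewrite leNgt; apply/negP => kt.
have lt_kt4 : 6 ^+ 4 < (k.+1%:R * t) ^+ 4 by rewrite ltrXn2r // nnegrE mulr_ge0.
have le_ku4 : (k.+1%:R * t) ^+ 4 <= k.+1%:R ^+ 4 * u ^+ 4.
  by rewrite exprMn ler_wpM2l ?exprn_ge0 // lerXn2r // nnegrE ltW.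
have : 16 * k.+1%:R ^+ 4 * u ^+ 4 <= 2 ^+ k * u ^+ 4.
  by rewrite ler_wpM2r ?ler_16X4_2X // exprn_ge0 // ltW.
lra.
Qed.

Lemma ex_dyadic_exponent n : 144 ^+ 2 <= n%:R * u ^+ 4 ->
  exists k, [/\ (8 <= k)%N, 144 ^+ 2 <= 2 ^+ k * u ^+ 4 & k%:R * (a ^+ 4 * (1 - a)) <= 6].
Proof.
move=> nu; have exk : exists k, 144 ^+ 2 <= 2 ^+ k * u ^+ 4.
  exists n; apply: le_trans nu _; rewrite ler_wpM2r ?exprn_ge0 ?(ltW u_gt0) //.
  by rewrite -natrX ler_nat ltnW // ltn_expl.
case: (ex_minnP exk) => k k_large mink; exists k.
have k_ge8 : (8 <= k)%N.
  rewrite leqNgt; apply: contraL k_large => k_lt8; rewrite -ltNge.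
  apply: (@le_lt_trans _ _ (2 ^+ 8 * 1)); last by lra.
  have le_2X8 : 2 ^+ k <= 2 ^+ 8 :> R by rewrite ler_weXn2l ?ler1n // ltnW.
  by rewrite ler_pM ?exprn_ge0 ?(ltW u_gt0).
split=> //; case: k mink {k_large} k_ge8 => // k mink _.
by apply: dyadic_exponent_le; rewrite ltNge; apply/negP => /mink; rewrite ltnn.
Qed.

Lemma exponent_budget (K T k J : nat) : (8 <= k)%N ->
  K%:R * a <= 10 -> T%:R * (1 - a) <= 3 -> k%:R * (a ^+ 4 * (1 - a)) <= 6 ->
  J%:R * u ^+ 2 <= 25 ->
  (J * (9 + 2 * (k + 2 * (K * (T * k)))))%:R * (a ^+ 7 * (1 - a) ^+ 4) <= 18600.
Proof.
move=> k_ge8 Ka Tb kt Ju.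
have k8 : 8 <= k%:R :> R by rewrite (ler_nat R 8).
set Z := (9 + _)%N; have Zu : Z%:R * u <= 124 * k%:R.
  have -> : Z%:R * u = (9 + 2 * k%:R) * u + 4 * k%:R * ((K%:R * a) * (T%:R * (1 - a))).
    by rewrite /Z; ring.
  have : 4 * k%:R * ((K%:R * a) * (T%:R * (1 - a))) <= 4 * k%:R * (10 * 3).
    by rewrite ler_wpM2l ?mulr_ge0 // ler_pM // mulr_ge0 // ltW.
  have : (9 + 2 * k%:R) * u <= 4 * k%:R * 1.
    by apply: ler_pM; move: u_gt0 u_le4 k8; lra.
  by lra.
have JZu : (J * Z)%:R * u ^+ 3 <= 25 * (124 * k%:R).
  have -> : (J * Z)%:R * u ^+ 3 = (J%:R * u ^+ 2) * (Z%:R * u) by rewrite natrM; ring.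
  by rewrite ler_pM // mulr_ge0 ?exprn_ge0 // ltW.
have -> : (J * Z)%:R * (a ^+ 7 * (1 - a) ^+ 4) = (J * Z)%:R * u ^+ 3 * (a ^+ 4 * (1 - a)).
  by ring.
apply: (@le_trans _ _ (25 * (124 * k%:R) * (a ^+ 4 * (1 - a)))); last by move: kt; lra.
by rewrite ler_wpM2r // mulr_ge0 ?exprn_ge0 // ltW.
Qed.

Lemma weight_le_exprn i : (i <= 4)%N -> a ^+ 7 * (1 - a) ^+ 4 <= u ^+ i.
Proof.
move=> i4; have -> : a ^+ 7 * (1 - a) ^+ 4 = u ^+ 4 * a ^+ 3 by ring.
apply: (@le_trans _ _ (u ^+ 4 * 1)).
  by rewrite ler_wpM2l ?exprn_ge0 ?(ltW u_gt0) // exprn_ile1 // ltW.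
by rewrite mulr1 ler_wiXn2l // ltW //; move: u_le4; lra.
Qed.

Lemma degree_mass_ge (n : nat) i : 144 ^+ 2 <= a ^+ 7 * (1 - a) ^+ 4 * n%:R -> (i <= 4)%N ->
  144 ^+ 2 <= n%:R * u ^+ i.
Proof.
by move=> n_large i4; apply: le_trans n_large _; rewrite mulrC ler_wpM2l ?weight_le_exprn.
Qed.

(* [4 ^+ K.+1] will bound the product of the inverses of the clipped moduli, [T * k] is the
   exponent of the reflection inequality, [2 ^+ k] absorbs the bounds at the centre that do
   not depend on the degree, and [J] steps of the growth give a factor [2]. *)
Lemma ex_exponents m : 144 ^+ 2 <= a ^+ 7 * (1 - a) ^+ 4 * m.+1%:R ->
  exists K T k J : nat, [/\ 8 <= K%:R * a, 2 <= T%:R * (1 - a),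
    (8 <= k)%N /\ 144 ^+ 2 <= 2 ^+ k * u ^+ 4, 24 <= J%:R * u ^+ 2 &
    (J * (9 + 2 * (k + 2 * (K.+1 * (T * k)))) <= m)%N].
Proof.
move=> m_large; set n := m.+1 in m_large *; have mass := degree_mass_ge m_large.
have le_n x y : u <= x -> y <= 144 ^+ 2 -> y <= n%:R * x.
  by move=> ux y_le; apply: le_trans y_le (le_trans (mass 1%N isT) _); rewrite ler_wpM2l.
have ua : u <= a by rewrite ger_pMr // gerBl ltW.
have ub : u <= 1 - a by rewrite ger_pMl // ltW.
have [K /andP[K_ge K_le]] : exists K : nat, 8 <= K%:R * a <= 8 + a.
  by apply: (@ex_natmul_between _ _ _ n) => //; apply: le_n ua _; lra.
have [T /andP[T_ge T_le]] : exists T : nat, 2 <= T%:R * (1 - a) <= 2 + (1 - a).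
  by apply: (@ex_natmul_between _ _ _ n) => //; apply: le_n ub _; lra.
have [J /andP[J_ge J_le]] : exists J : nat, 24 <= J%:R * u ^+ 2 <= 24 + u ^+ 2.
  by apply: (@ex_natmul_between _ _ _ n); rewrite ?exprn_gt0 //; move: (mass 2%N isT); lra.
have [k [k_ge8 k_large kt]] := ex_dyadic_exponent (mass 4%N isT).
exists K, T, k, J; split=> //; rewrite -ltnS -/n -(ltr_nat R).
have weight_gt0 : 0 < a ^+ 7 * (1 - a) ^+ 4 by rewrite mulr_gt0 ?exprn_gt0.
rewrite -(ltr_pM2r weight_gt0) [ltRHS]mulrC; apply: lt_le_trans m_large.
apply: le_lt_trans (exponent_budget k_ge8 _ _ kt _) _.
- by rewrite -natr1; move: K_le a_lt1; lra.
- by move: T_le a_gt0; lra.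
- by have := uX_le1 2; move: J_le; lra.
- by lra.
Qed.

End Exponents.

(** * Laguerre's theorem *)

Lemma sumr_gt0_seq (R : numDomainType) (I : eqType) (r : seq I) (F : I -> R) :
  r != [::] -> {in r, forall i, 0 < F i} -> 0 < \sum_(i <- r) F i.
Proof.
case: r => // i r _ F_gt0; rewrite big_cons ltr_pwDl ?F_gt0 ?mem_head //.
by rewrite big_seq sumr_ge0 // => j jr; rewrite ltW // F_gt0 // inE jr orbT.
Qed.

Section Laguerre.
Variable C : numClosedFieldType.
Local Notation R := (creal C).
Implicit Types (z u b c w y g : C) (q r : R) (s : seq C).

Lemma horner_deriv_prod_XsubC s z : z \notin s ->
  (\prod_(g <- s) ('X - g%:P))^`().[z] =
  (\prod_(g <- s) ('X - g%:P)).[z] * \sum_(g <- s) (z - g)^-1.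
Proof.
elim: s => [|g s IHs]; first by rewrite !big_nil derivC horner0 mulr0.
rewrite inE negb_or => /andP[zg /IHs {}IHs]; rewrite !big_cons derivM derivXsubC.
rewrite mul1r hornerD !hornerM IHs hornerXsubC.
have zg0 : z - g != 0 by rewrite subr_eq0.
by field.
Qed.

Lemma gauss_lucas r s w : {in s, forall g, nrm g <= r} -> s != [::] ->
  root (\prod_(g <- s) ('X - g%:P))^`() w -> nrm w <= r.
Proof.
move=> s_le sN; have [/s_le //|ws] := boolP (w \in s).
have ws0 g : g \in s -> w - g != 0.
  by move=> gs; rewrite subr_eq0; apply: contraNneq ws => ->.
rewrite /root horner_deriv_prod_XsubC // mulf_eq0 -/(root _ w) root_prod_XsubC (negbTE ws) /=.
move=> /eqP sum0; rewrite leNgt; apply/negP => w_gt.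
suff : 0 < \sum_(g <- s) re (w * (w - g)^-1).
  by rewrite -raddf_sum -mulr_sumr sum0 mulr0 raddf0 ltxx.
apply: sumr_gt0_seq => // g gs; have wg := ws0 g gs.
have ratioB1 : g * (w - g)^-1 = w * (w - g)^-1 + (-1)%:C by rewrite rmorphN1; field.
have : nrm (g * (w - g)^-1) < nrm (w * (w - g)^-1).
  by rewrite !nrmM ltr_pM2r ?nrm_gt0 ?invr_eq0 // (le_lt_trans (s_le g gs)).
rewrite -(@ltr_pXn2r _ 2) ?nnegrE ?nrm_ge0 // ratioB1 sqr_nrmD_real.
by move: (re _) (nrm _ ^+ 2) => *; lra.
Qed.

(* For [0 <= q < 1] and [c != b], a closed disk that contains [c] but not [b]. *)
Definition apollonius c b q z := nrm (c - z) <= q * nrm (b - z).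

Lemma apolloniusE c b q z : 0 <= q ->
  apollonius c b q z = (nrm (c - z) ^+ 2 <= q ^+ 2 * nrm (b - z) ^+ 2).
Proof. by move=> q0; rewrite -exprMn ler_pXn2r // ?nnegrE ?mulr_ge0 ?nrm_ge0. Qed.

Section InversionGap.
Variables (c b z : C) (q : R).
Hypotheses (q01 : 0 <= q < 1) (Dz : apollonius c b q z).

(* Inversion about the point [z] of the disk maps the outside of the disk onto the convex
   set [0 < inversion_gap]. *)
Definition inversion_gap y : R :=
  nrm ((c - z) * y + 1) ^+ 2 - q ^+ 2 * nrm ((b - z) * y + 1) ^+ 2.

Lemma inversion_gap0 : 0 < inversion_gap 0.
Proof.
case/andP: q01 => q0 q1.
by rewrite /inversion_gap !mulr0 add0r nrm1 expr1n mulr1 subr_gt0 expr_lt1.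
Qed.

Lemma inversion_gapV g : z != g -> (0 < inversion_gap (z - g)^-1) = ~~ apollonius c b q g.
Proof.
case/andP: q01 => q0 _; rewrite -subr_eq0 => zg.
have shift x : (x - z) * (z - g)^-1 + 1 = (x - g) * (z - g)^-1 by field.
rewrite apolloniusE // -ltNge /inversion_gap !shift !nrmM !exprMn [q ^+ 2 * (_ * _)]mulrA -mulrBl.
by rewrite pmulr_lgt0 ?subr_gt0 // exprn_gt0 // nrm_gt0 invr_eq0.
Qed.

Lemma inversion_gap_tangent y0 :
  exists k : C, forall y, inversion_gap y <= inversion_gap y0 + re (k * (y - y0)).
Proof.
case/andP: q01 => q0 _; pose A := q ^+ 2 * nrm (b - z) ^+ 2 - nrm (c - z) ^+ 2.
have A0 : 0 <= A by move: Dz; rewrite apolloniusE // subr_ge0.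
pose k := (c - z) - (q ^+ 2)%:C * (b - z) - A%:C * y0^*; exists (k + k) => y.
rewrite -subr_ge0 (_ : _ - _ = A * nrm (y - y0) ^+ 2); first by rewrite mulr_ge0 ?sqr_ge0.
by rewrite /k /inversion_gap /A; move: (c - z) (b - z) => v v'; rewrite !sqr_nrm !coordE; ring.
Qed.

Lemma inversion_gap_mean_gt0 (ys : seq C) y0 : ys != [::] ->
  \sum_(y <- ys) y = (size ys)%:R * y0 ->
  {in ys, forall y, 0 < inversion_gap y} -> 0 < inversion_gap y0.
Proof.
move=> ysN mean gap_gt0; rewrite ltNge; apply/negP => gap_le0.
have [k tangent] := inversion_gap_tangent y0.
suff : 0 < \sum_(y <- ys) re (k * (y - y0)).
  rewrite -raddf_sum -mulr_sumr sumrB mean big_const_seq count_predT iter_addr_0.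
  by rewrite mulr_natl subrr mulr0 raddf0 ltxx.
apply: sumr_gt0_seq => // y /gap_gt0 gap_y.
by have := tangent y; move: gap_y gap_le0; lra.
Qed.

End InversionGap.

Lemma laguerre c b q (k : nat) (G : {poly C}) u z : 0 <= q < 1 ->
  (0 < k)%N -> (size G <= k.+1)%N -> apollonius c b q u -> apollonius c b q z ->
  k%:R * G.[z] + (u - z) * G^`().[z] = 0 ->
  exists2 g, apollonius c b q g & root G g.
Proof.
move=> q01 k_gt0 sG Du Dz polar0.
have [G0|GN0] := eqVneq G 0; first by exists z; rewrite // G0 root0.
have [s Gs] := closed_field_poly_normal G.
have lG : lead_coef G != 0 by rewrite lead_coef_eq0.
have rootG g : root G g = (g \in s) by rewrite Gs rootZ // root_prod_XsubC.
have sk : (size s <= k)%N by move: sG; rewrite Gs size_scale // size_prod_XsubC.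
have [/hasP[g gs Dg]|/hasPn noD] := boolP (has (apollonius c b q) s).
  by exists g; rewrite // rootG.
have zs : z \notin s by apply: contraL Dz => /noD.
have polar_sum : k%:R + (u - z) * \sum_(g <- s) (z - g)^-1 = 0.
  have Gz : G.[z] != 0 by rewrite -/(root G z) rootG.
  apply: (mulfI Gz); rewrite mulr0 -[RHS]polar0 Gs derivZ !hornerZ horner_deriv_prod_XsubC //.
  ring.
have zu : z - u != 0.
  apply: contra_eq_neq polar_sum => /eqP; rewrite subr_eq0 => /eqP ->.
  by rewrite subrr mul0r addr0 pnatr_eq0 -lt0n.
(* The missing roots are at infinity, where inversion gives 0. *)
pose ys := [seq (z - g)^-1 | g <- s] ++ nseq (k - size s) 0.
have sys : size ys = k by rewrite size_cat size_map size_nseq subnKC.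
have : 0 < inversion_gap c b z q (z - u)^-1.
  apply: (@inversion_gap_mean_gt0 c b z q q01 Dz ys); first by rewrite -size_eq0 sys -lt0n.
    apply: (mulfI zu); rewrite big_cat big_map big_nseq iter_addr_0 mul0rn /= addr0 sys.
    rewrite mulrCA divff // mulr1; apply/esym/eqP.
    by rewrite -subr_eq0 -mulNr opprB polar_sum.
  move=> y; rewrite mem_cat => /orP[/mapP[g gs ->]|/nseqP[-> _]].
    by rewrite inversion_gapV // ?noD //; apply: contraNneq zs => ->.
  exact: inversion_gap0.
by rewrite inversion_gapV ?Du // -subr_eq0.
Qed.

End Laguerre.

(** * Grace's theorem *)

Section Grace.
Variables (C : numClosedFieldType) (l : {scalar {poly C}}).
Implicit Types (f : {poly C}) (z c b : C) (s : seq C).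

Fixpoint power_pairing f (k : nat) : {poly C} :=
  if k is k'.+1 then power_pairing (f * 'X) k' - 'X * power_pairing f k' else (l f)%:P.

Lemma horner_power_pairing f k z : (power_pairing f k).[z] = l (f * ('X - z%:P) ^+ k).
Proof.
elim: k f => [|k IHk] f /=; first by rewrite hornerC expr0 mulr1.
rewrite hornerD hornerN hornerM hornerX !IHk -[z * _]linearZ -linearB /=.
by congr (l _); rewrite exprS -mul_polyC; ring.
Qed.

Lemma size_power_pairing f k : (size (power_pairing f k) <= k.+1)%N.
Proof.
elim: k f => [|k IHk] f /=; first exact: size_polyC_leq1.
apply: leq_trans (size_polyD _ _) _; rewrite size_polyN geq_max (leq_trans (IHk _)) //=.
by apply: leq_trans (size_polyMleq _ _) _; rewrite size_polyX ltnS.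
Qed.

Lemma deriv_power_pairing f k :
  (power_pairing f k.+1)^`() = - (k.+1%:R *: power_pairing f k).
Proof.
have pairingS g i : power_pairing g i.+1 = power_pairing (g * 'X) i - 'X * power_pairing g i.
  by [].
elim: k f => [|k IHk] f.
  by rewrite /= derivB derivC derivM derivX derivC mulr0 addr0 mul1r sub0r scale1r.
rewrite pairingS derivB derivM derivX !IHk pairingS -!mul_polyC -[k.+2%:R]natr1.
by rewrite polyCD polyC1; ring.
Qed.

Theorem grace c b q f s : 0 <= q < 1 -> all (apollonius c b q) s ->
  l (f * \prod_(g <- s) ('X - g%:P)) = 0 ->
  exists2 z, apollonius c b q z & l (f * ('X - z%:P) ^+ size s) = 0.
Proof.
move=> q01; case/andP: (q01) => q0 _; elim: s f => [|g s IHs] f /=.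
  move=> _; rewrite big_nil => l0; exists c; last by rewrite expr0.
  by rewrite /apollonius subrr nrm0 mulr_ge0 ?nrm_ge0.
move=> /andP[Dg Ds]; rewrite big_cons mulrA => /(IHs _ Ds)[z Dz lz].
have [] := @laguerre C c b q (size s).+1 (power_pairing f (size s).+1) g z q01 _ _ Dg Dz.
- by [].
- exact: size_power_pairing.
- rewrite deriv_power_pairing hornerN hornerZ !horner_power_pairing.
  have -> : l (f * ('X - z%:P) ^+ (size s).+1) = (g - z) * l (f * ('X - z%:P) ^+ size s).
    rewrite -linearZ /= -[RHS]add0r -lz -linearD /=; congr (l _).
    by rewrite exprS -mul_polyC polyCB; ring.
  ring.
by move=> w Dw /rootP; rewrite horner_power_pairing => lw; exists w.
Qed.

End Grace.

(** * Coincidence for integrals *)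

Section Coincidence.
Variable C : numClosedFieldType.
Local Notation R := (creal C).
Implicit Types (b c u z : C) (q x : R) (s : seq C) (f P : {poly C}).

(* The constant coefficient is 0 because of [x / 0 = 0]. *)
Definition primitive f : {poly C} := \poly_(i < (size f).+1) (f`_i.-1 / i%:R).

Lemma coef_primitive f i : (primitive f)`_i = f`_i.-1 / i%:R.
Proof.
rewrite coef_poly; case: ltnP => // si; rewrite nth_default ?mul0r //.
by case: i si.
Qed.

Lemma primitive_is_linear : linear primitive.
Proof.
by move=> k f g; apply/polyP=> i; rewrite coefD coefZ !coef_primitive coefD coefZ; ring.
Qed.

Lemma primitive_deriv P : primitive P^`() = P - (P`_0)%:P.
Proof.
apply/polyP=> i; rewrite coef_primitive coefB coefC coef_deriv.
case: i => [|i] /=; first by rewrite invr0 mulr0 subrr.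
by rewrite subr0 -(mulr_natr P`_i.+1) mulfK ?pnatr_eq0.
Qed.

Definition integral_sub_eval b c (tau : C) f : C :=
  (primitive f).[b] - (primitive f).[c] - tau * f.[b].

Lemma integral_sub_eval_is_scalar b c tau : scalar (integral_sub_eval b c tau).
Proof.
by move=> k f g; rewrite /integral_sub_eval primitive_is_linear !hornerD !hornerZ; ring.
Qed.

HB.instance Definition _ b c tau :=
  GRing.isLinear.Build C {poly C} C *%R (integral_sub_eval b c tau)
    (integral_sub_eval_is_scalar b c tau).

Lemma integral_sub_eval_deriv b c tau P :
  integral_sub_eval b c tau P^`() = P.[b] - P.[c] - tau * P^`().[b].
Proof. by rewrite /integral_sub_eval primitive_deriv !hornerD !hornerN !hornerC; ring. Qed.

Lemma mulr1B_geom_sum u n : (1 - u) * \sum_(i < n) u ^+ i = 1 - u ^+ n.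
Proof. by rewrite -opprB mulNr -subrX1 opprB. Qed.

(* Grace's theorem moves all the critical points to a single point [z], and
   [u = (c - z) / (b - z)]. *)
Theorem coincidence b c q s P : 0 <= q < 1 -> c != b -> all (apollonius c b q) s ->
  P^`() = (size s).+1%:R *: \prod_(g <- s) ('X - g%:P) ->
  exists2 u, nrm u <= q & P.[b] - P.[c] =
    (b - c) * (\prod_(g <- s) ('X - g%:P)).[b] * \sum_(i < (size s).+1) u ^+ i.
Proof.
move=> q01 cb Ds dP; set n := (size s).+1 in dP *.
have bz z : apollonius c b q z -> b - z != 0.
  rewrite /apollonius => Dz; apply: contra_neq cb => bz0; move: Dz.
  rewrite bz0 nrm0 mulr0 le_eqVlt ltNge nrm_ge0 orbF nrm_eq0 subr_eq0 => /eqP ->.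
  by apply/esym/eqP; rewrite -subr_eq0 bz0.
have nN0 : n%:R != 0 :> C by rewrite pnatr_eq0.
have prod_b : (\prod_(g <- s) ('X - g%:P)).[b] != 0.
  rewrite horner_prod prodf_seq_neq0; apply/allP => g /(allP Ds) /bz.
  by rewrite hornerXsubC.
have dPb : P^`().[b] != 0 by rewrite dP hornerZ mulf_neq0.
pose tau := (P.[b] - P.[c]) / P^`().[b].
have [|z Dz] := @grace C (integral_sub_eval b c tau) c b q 1 s q01 Ds.
  apply: (mulfI nN0); rewrite mul1r -linearZ /= -dP integral_sub_eval_deriv /tau divfK //.
  by rewrite subrr mulr0.
rewrite mul1r /= => lz; have zb := bz z Dz.
have tauE : (b - z) ^+ n - (c - z) ^+ n = n%:R * tau * (b - z) ^+ size s.
  have := integral_sub_eval_deriv b c tau (('X - z%:P) ^+ n).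
  rewrite deriv_exp derivXsubC mul1r -scaler_nat linearZ /= lz mulr0.
  rewrite hornerZ !horner_exp !hornerXsubC => /esym/eqP.
  by rewrite subr_eq0 => /eqP ->; ring.
pose u := (c - z) / (b - z); exists u; first by rewrite nrmM nrmV ler_pdivrMr // nrm_gt0.
have -> : P.[b] - P.[c] = (\prod_(g <- s) ('X - g%:P)).[b] * (n%:R * tau).
  by rewrite mulrA [X in X * tau]mulrC -hornerZ -dP /tau mulrCA divff ?mulr1.
rewrite [(b - c) * _]mulrC -mulrA; congr (_ * _).
apply: (mulIf (expf_neq0 (size s) zb)).
have czE : c - z = (b - z) * u by rewrite /u mulrCA divff ?mulr1.
have bcE : b - c = (b - z) * (1 - u) by rewrite mulrBr -czE; ring.
rewrite -tauE czE bcE exprMn; set S := \sum_(i < n) _.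
transitivity ((b - z) ^+ n * ((1 - u) * S)); last by rewrite /n exprS; ring.
by rewrite mulr1B_geom_sum; ring.
Qed.

Lemma nrm_geom_sum_ge u x n : 0 <= x <= 1 -> 1 <= n%:R * x -> nrm u <= 1 - x ->
  1 / 4 <= nrm (\sum_(i < n) u ^+ i).
Proof.
move=> x01 nx ux; have un : nrm u ^+ n <= 1 / 2.
  apply: le_trans (expr_1B_le_half x01 nx).
  by rewrite lerXn2r // nnegrE ?nrm_ge0 // subr_ge0; case/andP: x01.
have := nrmB_ge 1 (u ^+ n); rewrite nrm1 nrmX -mulr1B_geom_sum nrmM.
have : nrm (1 - u) <= 2 by have := nrmD_le 1 (- u); rewrite nrmN nrm1; lra.
by have := nrm_ge0 (\sum_(i < n) u ^+ i); nra.
Qed.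

Lemma nrm_geom_sum_le u x n : 0 <= x -> nrm u <= 1 - x ->
  x * nrm (\sum_(i < n) u ^+ i) <= 2.
Proof.
move=> x0 ux; apply: le_trans (_ : nrm (1 - u ^+ n) <= _).
  rewrite -mulr1B_geom_sum nrmM ler_wpM2r ?nrm_ge0 //.
  by have := nrmB_ge 1 u; rewrite nrm1; lra.
have := nrmD_le 1 (- u ^+ n); rewrite nrmN nrm1 nrmX.
by have : nrm u ^+ n <= 1 by [rewrite exprn_ile1 ?nrm_ge0 //; lra]; lra.
Qed.

Section CoincidenceAtRoot.
Variables (a : C) (p : {poly C}) (s : seq C).
Hypothesis dP : (('X - a%:P) * p)^`() = (size s).+1%:R *: \prod_(g <- s) ('X - g%:P).
Local Notation crit := (\prod_(g <- s) ('X - g%:P)).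

Lemma quotient_coincidence_root c q : 0 <= q < 1 -> c != a -> all (apollonius c a q) s ->
  exists2 u, nrm u <= q & p.[c] = crit.[a] * \sum_(i < (size s).+1) u ^+ i.
Proof.
move=> q01 ca Ds; have [u uq] := coincidence q01 ca Ds dP.
rewrite !hornerM !hornerXsubC subrr mul0r sub0r -mulrA -mulNr opprB => e; exists u => //.
by apply: (mulfI _ e); rewrite subr_eq0 eq_sym.
Qed.

Lemma quotient_coincidence b q : 0 <= q < 1 -> b != a -> all (apollonius a b q) s ->
  exists2 u, nrm u <= q & p.[b] = crit.[b] * \sum_(i < (size s).+1) u ^+ i.
Proof.
move=> q01 ba; rewrite eq_sym in ba => Ds; have [u uq] := coincidence q01 ba Ds dP.
rewrite !hornerM !hornerXsubC subrr mul0r subr0 -mulrA => e; exists u => //.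
by apply: (mulfI _ e); rewrite subr_eq0 eq_sym.
Qed.

End CoincidenceAtRoot.
End Coincidence.

(** * The lune of far critical points *)

Section Lune.
Variable C : numClosedFieldType.
Local Notation R := (creal C).

Definition lune (a : R) (g : C) := (nrm g <= 1) && (1 <= nrm (a%:C - g)).

Variables (a : R) (g : C).
Hypotheses (a_gt0 : 0 < a) (a_lt1 : a < 1) (lune_g : lune a g).
Implicit Types (c : C) (t e : R).

Let nrm_ag : 1 <= nrm (a%:C - g). Proof. by case/andP: lune_g. Qed.
Let sqr_ag : 1 <= nrm (a%:C - g) ^+ 2. Proof. exact: exprn_ege1. Qed.

(* Equivalently, the real part of [1 / (a - g)] is at least [a / 2]. *)
Lemma lune_re : a * nrm (a%:C - g) ^+ 2 <= 2 * re (a%:C - g).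
Proof.
have : nrm g ^+ 2 <= 1 by case/andP: lune_g => g1 _; rewrite exprn_ile1 ?nrm_ge0.
have -> : nrm g = nrm (a%:C - g + (- a)%:C).
  by rewrite rmorphN /= -(nrmN g); congr nrm; ring.
rewrite sqr_nrmD_real => g1; rewrite -(ler_pM2l a_gt0).
have : 0 <= (nrm (a%:C - g) ^+ 2 - 1) * (1 - a ^+ 2).
  by rewrite mulr_ge0 ?subr_ge0 // exprn_ile1 // ltW.
by move: (re _) (nrm _ ^+ 2) g1 => X M; lra.
Qed.

Lemma sqr_nrm_shift t :
  nrm ((a + t)%:C - g) ^+ 2 = nrm (a%:C - g) ^+ 2 + 2 * t * re (a%:C - g) + t ^+ 2.
Proof. by rewrite -sqr_nrmD_real rmorphD; congr (nrm _ ^+ 2) => /=; ring. Qed.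

Lemma lune_apollonius_left t : 0 <= t <= a ->
  apollonius (a - t)%:C a%:C (1 - t * (a - t) / 2) g.
Proof.
move=> /andP[t0 ta]; have ratio_ge0 : 0 <= 1 - t * (a - t) / 2 by move: a_lt1; nra.
rewrite apolloniusE // sqr_nrm_shift.
move: (nrm _ ^+ 2) (re _) sqr_ag lune_re => M X M_ge1 MX.
have : 0 <= t * (2 * X - a * M) by rewrite mulr_ge0 ?subr_ge0.
have : 0 <= t ^+ 2 * (M - 1) by rewrite mulr_ge0 ?sqr_ge0 ?subr_ge0.
have : 0 <= (t * (a - t)) ^+ 2 * M by rewrite mulr_ge0 ?sqr_ge0 //; lra.
lra.
Qed.

Lemma lune_apollonius_near_left e c : 0 <= e <= a / 4 -> nrm (c - (a - e)%:C) <= a * e / 4 ->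
  apollonius c a%:C (1 - e * a / 8) g.
Proof.
move=> /andP[e0 ea] c_near; rewrite /apollonius.
have -> : c - g = c - (a - e)%:C + ((a - e)%:C - g) by ring.
apply: le_trans (nrmD_le _ _) _.
have : apollonius (a - e)%:C a%:C (1 - e * (a - e) / 2) g.
  by apply: lune_apollonius_left; lra.
rewrite /apollonius; move: (nrm (c - _)) (nrm (_ - g)) (nrm (_ - g)) nrm_ag c_near.
move=> d N M M_ge1 d_le N_le; have ae0 : 0 <= a * e / 4 by move: a_gt0; nra.
have : a * e / 4 <= a * e / 4 * M by rewrite ler_peMr.
have : 0 <= e * (a / 4 - e) * M by rewrite !mulr_ge0 ?subr_ge0 //; lra.
lra.
Qed.

Lemma lune_growth e : 0 <= e ->
  (1 + e * a) * nrm (a%:C - g) ^+ 2 <= nrm ((a + e)%:C - g) ^+ 2.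
Proof.
move=> e0; rewrite sqr_nrm_shift; move: (nrm _ ^+ 2) (re _) lune_re => M X MX.
have : 0 <= e * (2 * X - a * M) by rewrite mulr_ge0 ?subr_ge0.
by have := sqr_ge0 e; lra.
Qed.

Lemma lune_apollonius_right e : 0 <= e -> e * a <= 1 ->
  apollonius a%:C (a + e)%:C (1 - e * a / 4) g.
Proof.
move=> e0 ea1; have ea0 : 0 <= e * a by rewrite mulr_ge0 // ltW.
rewrite apolloniusE; last by lra.
have ratio : 1 <= (1 - e * a / 4) ^+ 2 * (1 + e * a) by nra.
apply: le_trans (_ : (1 - e * a / 4) ^+ 2 * ((1 + e * a) * nrm (a%:C - g) ^+ 2) <= _).
  by rewrite mulrA ler_peMl ?sqr_ge0.
by rewrite ler_wpM2l ?sqr_ge0 ?lune_growth.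
Qed.

End Lune.

(** * Reflection of the roots in the unit circle *)

Section Reflection.
Variable C : numClosedFieldType.
Local Notation R := (creal C).
Implicit Types (z : C) (x c d t y : R).

Definition reflected z x : C := 1 - z^* * x%:C.

Lemma sqr_nrm_reflected z x :
  nrm (reflected z x) ^+ 2 = nrm (x%:C - z) ^+ 2 + (1 - x ^+ 2) * (1 - nrm z ^+ 2).
Proof. by rewrite /reflected !sqr_nrm !coordE; ring. Qed.

Lemma nrm_le_reflected z x : nrm z <= 1 -> 0 <= x <= 1 ->
  nrm (x%:C - z) <= nrm (reflected z x).
Proof.
move=> z1 /andP[x0 x1]; rewrite -(@ler_pXn2r _ 2) ?nnegrE ?nrm_ge0 // sqr_nrm_reflected.
by rewrite lerDl mulr_ge0 ?subr_ge0 ?exprn_ile1 ?nrm_ge0.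
Qed.

Lemma nrm_conjM_real z x : 0 <= x -> nrm (z^* * x%:C) = nrm z * x.
Proof. by move=> x0; rewrite nrmM nrm_conj nrm_of_creal. Qed.

Lemma nrm_reflected_le2 z x : nrm z <= 1 -> 0 <= x <= 1 -> nrm (reflected z x) <= 2.
Proof.
move=> z1 /andP[x0 x1]; apply: le_trans (nrmD_le _ _) _.
by rewrite nrmN nrm1 nrm_conjM_real // lerD2l mulr_ile1 ?nrm_ge0.
Qed.

Lemma nrm_reflected_ge1B z x : nrm z <= 1 -> 0 <= x -> 1 - x <= nrm (reflected z x).
Proof.
move=> z1 x0; apply: le_trans (nrmB_ge _ _).
by rewrite nrm1 nrm_conjM_real // lerD2l lerN2 ler_piMl.
Qed.

(* A quantitative form of the mean value property of the harmonic function
   [x |-> ln |reflected z x|]. *)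
Lemma nrm_reflected_midpoint z c t y : nrm z <= 1 -> 0 <= c <= 1 -> 0 <= t ->
  0 <= y -> t ^+ 2 <= y * (1 - c) ^+ 2 ->
  nrm (reflected z (c + t)) * nrm (reflected z (c - t)) <=
  nrm (reflected z c) ^+ 2 * (1 + y).
Proof.
move=> z1 /andP[c0 c1] t0 y0 ty; rewrite -nrmM -nrmX.
have -> : reflected z (c + t) * reflected z (c - t) =
    reflected z c ^+ 2 - (z^* * t%:C) ^+ 2 by rewrite /reflected rmorphD rmorphB; ring.
apply: le_trans (nrmD_le _ _) _; rewrite nrmN mulrDr mulr1 lerD2l !nrmX nrm_conjM_real //.
apply: (@le_trans _ _ (1 * t ^+ 2)).
  by rewrite exprMn ler_wpM2r ?sqr_ge0 // exprn_ile1 ?nrm_ge0.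
rewrite mul1r mulrC; apply: le_trans ty _; rewrite ler_wpM2l //.
by rewrite lerXn2r ?nnegrE ?nrm_ge0 ?subr_ge0 // nrm_reflected_ge1B.
Qed.

Definition clipped_nrm z : R := Num.max (nrm z) (1 / 2).

Lemma clipped_nrm_gt0 z : 0 < clipped_nrm z.
Proof. by rewrite lt_max divr_gt0 ?orbT. Qed.

Lemma clipped_nrm_half z : 1 / 2 <= clipped_nrm z.
Proof. by rewrite le_max lexx orbT. Qed.

Lemma nrm_le_clipped z : nrm z <= clipped_nrm z.
Proof. by rewrite le_max lexx. Qed.

Lemma sqr_nrm_reflected_le_inner z c d (T k : nat) : nrm z <= 1 -> 0 <= c <= 1 ->
  clipped_nrm z <= 1 - d -> 0 <= d <= 1 -> 1 <= T%:R * d ->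
  4 <= 2 ^+ k * nrm (c%:C - z) ^+ 2 ->
  nrm (reflected z c) ^+ 2 <= nrm (c%:C - z) ^+ 2 * (clipped_nrm z)^-1 ^+ (T * k).
Proof.
move=> z1 c01 zd d01 Td far; have r_gt0 := clipped_nrm_gt0 z.
have ge2 : 2 <= (clipped_nrm z)^-1 ^+ T.
  rewrite exprVn -(invrK 2) lef_pV2 ?posrE ?exprn_gt0 ?invr_gt0 //.
  apply: (@le_trans _ _ ((1 - d) ^+ T)); last by have := expr_1B_le_half d01 Td; lra.
  by rewrite lerXn2r ?nnegrE ?(ltW r_gt0) // subr_ge0; case/andP: d01.
apply: (@le_trans _ _ (2 ^+ 2)).
  by rewrite lerXn2r ?nnegrE ?nrm_ge0 // nrm_reflected_le2.
apply: (@le_trans _ _ (nrm (c%:C - z) ^+ 2 * 2 ^+ k)); first by move: far; lra.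
by rewrite ler_wpM2l ?sqr_ge0 // exprM lerXn2r // ?nnegrE // (le_trans _ ge2).
Qed.

Lemma sqr_nrm_reflected_le_outer z c (E : nat) : 0 < nrm z <= 1 -> 0 <= c < 1 ->
  (1 + c) / 2 <= nrm z -> 16 <= E%:R * (1 - c) ->
  nrm (reflected z c) ^+ 2 <= nrm (c%:C - z) ^+ 2 * (nrm z)^-1 ^+ E.
Proof.
move=> /andP[z0 z1] /andP[c0 c1] cz Ec; rewrite sqr_nrm_reflected.
have dist_ge : (1 - c) / 2 <= nrm (c%:C - z).
  by have := nrmB_ge z c%:C; rewrite nrmBC nrm_of_creal //; lra.
have pow_ge : 1 + E%:R * (1 - nrm z) <= (nrm z)^-1 ^+ E.
  apply: (@le_trans _ _ ((1 + (1 - nrm z)) ^+ E)); first by apply: bernoulli; lra.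
  rewrite lerXn2r // ?nnegrE ?invr_ge0 ?nrm_ge0 //; first by lra.
  by rewrite -[leRHS]mul1r ler_pdivlMr //; have := sqr_ge0 (1 - nrm z); lra.
apply: (@le_trans _ _ (nrm (c%:C - z) ^+ 2 * (1 + E%:R * (1 - nrm z)))); last first.
  by rewrite ler_wpM2l ?sqr_ge0.
rewrite [leRHS]mulrDr mulr1 lerD2l mulrA.
have -> : (1 - c ^+ 2) * (1 - nrm z ^+ 2) = (1 - c) * ((1 + c) * (1 + nrm z)) * (1 - nrm z).
  by ring.
rewrite ler_wpM2r ?subr_ge0 //; apply: (@le_trans _ _ ((1 - c) * (2 * 2))).
  by rewrite ler_wpM2l ?subr_ge0 ?(ltW c1) // ler_pM //; lra.
apply: (@le_trans _ _ (((1 - c) / 2) ^+ 2 * E%:R)).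
  have : 0 <= (1 - c) * (E%:R * (1 - c) - 16) by rewrite mulr_ge0 ?subr_ge0 // ltW.
  lra.
by rewrite ler_wpM2r // lerXn2r ?nnegrE ?nrm_ge0 //; lra.
Qed.

Lemma sqr_nrm_reflected_le z a c (T k : nat) : nrm z <= 1 -> 0 <= c <= a -> a < 1 ->
  2 <= T%:R * (1 - a) -> (8 <= k)%N -> 4 <= 2 ^+ k * nrm (c%:C - z) ^+ 2 ->
  nrm (reflected z c) ^+ 2 <= nrm (c%:C - z) ^+ 2 * (clipped_nrm z)^-1 ^+ (T * k).
Proof.
move=> z1 /andP[c0 ca] a1 Ta k_ge8 far; have [z_inner|z_outer] := lerP (nrm z) ((1 + a) / 2).
  apply: (@sqr_nrm_reflected_le_inner z c ((1 - a) / 2)) => //; try lra.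
  by rewrite ge_max; lra.
have -> : clipped_nrm z = nrm z by apply/max_idPl; lra.
apply: sqr_nrm_reflected_le_outer; try lra.
have k8 : 8 <= k%:R :> R by rewrite (ler_nat R 8).
apply: (@le_trans _ _ ((T * k)%:R * (1 - a))); last by rewrite ler_wpM2l //; lra.
by rewrite natrM mulrAC; apply: (@le_trans _ _ (2 * 8)); [lra | rewrite ler_pM].
Qed.

End Reflection.

(** * Quantitative consequences *)

Section Step.
Variables (R : realFieldType) (a : R).
Hypotheses (a_gt0 : 0 < a) (a_lt1 : a < 1).

(* The largest [e] with [(3 / 2 * e) ^+ 2 <= e * a / 4 * (1 - a) ^+ 2], the condition for
   the midpoint inequality with increment [3 / 2 * e] to lose at most [1 + e * a / 4] per
   root. *)
Definition step : R := a * (1 - a) ^+ 2 / 9.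

Let b_gt0 : 0 < 1 - a. Proof. by rewrite subr_gt0. Qed.

Lemma step_gt0 : 0 < step.
Proof. by rewrite divr_gt0 // mulr_gt0 // exprn_gt0. Qed.

Lemma step_le_root : step <= a / 9.
Proof.
rewrite ler_pM2r ?invr_gt0 // ler_piMr ?(ltW a_gt0) //.
by rewrite exprn_ile1 ?(ltW b_gt0) // gerBl ltW.
Qed.

Lemma step_le_gap : step <= (1 - a) / 9.
Proof.
rewrite ler_pM2r ?invr_gt0 // expr2 mulrA ler_piMl ?(ltW b_gt0) //.
by rewrite mulr_ile1 ?(ltW a_gt0) ?(ltW b_gt0) ?(ltW a_lt1) // gerBl ltW.
Qed.

Lemma step_midpoint : (3 / 2 * step) ^+ 2 = step * a / 4 * (1 - a) ^+ 2.
Proof. by rewrite /step; field. Qed.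

Lemma step_mul_root : step * a = (a * (1 - a)) ^+ 2 / 9.
Proof. by rewrite /step; ring. Qed.

(* The constant of the theorem: [144 ^ 2 = 9 ^ 2 * 256]. *)
Lemma step_scales (n V J : R) : 144 ^+ 2 <= n * (a * (1 - a)) ^+ 2 ->
  144 ^+ 2 <= V * (a * (1 - a)) ^+ 4 -> 24 <= J * (a * (1 - a)) ^+ 2 ->
  [/\ 72 <= n * (step * a), 256 <= V * (step * a) ^+ 2 & 1 <= J * (3 / 8 * (step * a))].
Proof. by rewrite step_mul_root => n_large V_large J_large; split; lra. Qed.

End Step.

Section Growth.
Variable R : realFieldType.
Implicit Types x d L X Y Z B : R.

Lemma expr_1D_div_le_4X x (n K : nat) : (0 < n)%N -> 0 <= x <= K%:R ->
  (1 + x / n%:R) ^+ n <= 4 ^+ K.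
Proof.
move=> n_gt0 /andP[x0 xK]; have n0 : 0 < n%:R :> R by rewrite ltr0n.
have nV0 : 0 <= n%:R^-1 :> R by rewrite invr_ge0 ltW.
have base_ge0 : 0 <= 1 + n%:R^-1 :> R by rewrite addr_ge0.
apply: (@le_trans _ _ (((1 + n%:R^-1) ^+ K) ^+ n)).
  rewrite lerXn2r ?nnegrE ?exprn_ge0 ?addr_ge0 ?mulr_ge0 //.
  apply: le_trans (bernoulli _ _); first by rewrite lerD2l ler_wpM2r.
  by apply: le_trans nV0; rewrite oppr_le0.
rewrite exprAC lerXn2r ?nnegrE ?exprn_ge0 //.
by rewrite expr_1D_le4 // divff ?gt_eqF.
Qed.

Lemma three_point_growth_le (m : nat) d L X Y Z B : 0 < L -> 0 <= d <= 1 / 9 -> 0 <= X ->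
  (L / 4) ^+ 2 * (1 + d) ^+ m <= X ^+ 2 -> L / 4 <= Y ->
  0 <= Z <= L ^+ 2 * B -> X * Y <= Z * (1 + d / 4) ^+ m ->
  (1 + 3 / 8 * d) ^+ m <= 256 * B ^+ 2.
Proof.
move=> L0 /andP[d0 d1] X0 X_ge Y_ge /andP[Z0 Z_le] XY_le.
have L4 : 0 < L / 4 by rewrite divr_gt0.
have Y0 : 0 <= Y by apply: le_trans Y_ge; exact: ltW.
have base0 : 0 < (1 + d / 4) ^+ 2 by rewrite exprn_gt0 //; lra.
have split_base : (1 + 3 / 8 * d) * (1 + d / 4) ^+ 2 <= 1 + d.
  have : 0 <= d * (1 / 9 - d) by rewrite mulr_ge0 ?subr_ge0.
  have : 0 <= d ^+ 2 * (1 / 9 - d) by rewrite mulr_ge0 ?sqr_ge0 ?subr_ge0.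
  lra.
have lower : (L / 4) ^+ 4 * (1 + d) ^+ m <= (X * Y) ^+ 2.
  have pow0 : 0 <= (1 + d) ^+ m by rewrite exprn_ge0 ?addr_ge0.
  rewrite (exprD _ 2 2) mulrAC [leRHS]exprMn ler_pM ?sqr_ge0 //.
    by rewrite mulr_ge0 ?sqr_ge0.
  by rewrite lerXn2r ?nnegrE ?(ltW L4).
have upper : (X * Y) ^+ 2 <= L ^+ 4 * B ^+ 2 * ((1 + d / 4) ^+ 2) ^+ m.
  rewrite exprAC [leRHS](_ : _ = (L ^+ 2 * B * (1 + d / 4) ^+ m) ^+ 2); last by ring.
  have pow0 : 0 <= (1 + d / 4) ^+ m by rewrite exprn_ge0 //; lra.
  rewrite lerXn2r ?nnegrE ?(mulr_ge0 X0 Y0) ?(mulr_ge0 (le_trans Z0 Z_le)) //.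
  by apply: le_trans XY_le _; rewrite ler_wpM2r.
rewrite -(ler_pM2r (exprn_gt0 m base0)) -(ler_pM2l (exprn_gt0 4 L4)) -exprMn.
apply: (@le_trans _ _ ((L / 4) ^+ 4 * (1 + d) ^+ m)).
  by rewrite ler_wpM2l ?exprn_ge0 ?(ltW L4) // lerXn2r ?nnegrE ?mulr_ge0 //; lra.
apply: le_trans lower (le_trans upper _).
by move: (_ ^+ m) => P; rewrite le_eqVlt; apply/orP; left; apply/eqP; field.
Qed.

Lemma dyadic_lt_growth (m N J : nat) d : 0 <= d -> 1 <= J%:R * d ->
  (J * (9 + 2 * N) <= m)%N -> 256 * (2 ^+ N) ^+ 2 < (1 + d) ^+ m.
Proof.
move=> d0 Jd Jm; have pow2 : 256 = 2 ^+ 8 :> R by ring.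
rewrite pow2 -exprM mulnC -exprD.
apply: (@lt_le_trans _ _ (2 ^+ (9 + 2 * N))); first by rewrite ltr_eXn2l ?ltr1n.
apply: (@le_trans _ _ ((1 + d) ^+ (J * (9 + 2 * N)))); last by rewrite ler_weXn2l // lerDl.
rewrite exprM lerXn2r ?nnegrE ?exprn_ge0 ?addr_ge0 //.
by apply: le_trans (bernoulli _ _); lra.
Qed.

End Growth.

Lemma ler_prod_seq (R : numDomainType) (I : eqType) (r : seq I) (F G : I -> R) :
  {in r, forall i, 0 <= F i <= G i} ->
  \prod_(i <- r) F i <= \prod_(i <- r) G i.
Proof. by move=> FG; rewrite big_seq [leRHS]big_seq; apply: ler_prod. Qed.

Lemma prod_mulr_const (R : comNzRingType) (I : Type) (r : seq I) (F : I -> R) (c : R) :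
  \prod_(i <- r) (F i * c) = (\prod_(i <- r) F i) * c ^+ size r.
Proof. by rewrite big_split /= big_const_seq count_predT iter_mulr_1. Qed.

Lemma nrm_horner_prod_XsubC (C : numClosedFieldType) (r : seq C) (w : C) :
  nrm (\prod_(g <- r) ('X - g%:P)).[w] = \prod_(g <- r) nrm (w - g).
Proof.
by rewrite horner_prod nrm_prod; apply: eq_bigr => g _; rewrite hornerXsubC.
Qed.

Lemma prod_nrm_le_clipped (C : numClosedFieldType) (r : seq C) (c : creal C) : 0 <= c ->
  \prod_(z <- r) nrm (c%:C - z) <= (\prod_(z <- r) clipped_nrm z) * (1 + 2 * c) ^+ size r.
Proof.
move=> c0; rewrite -prod_mulr_const; apply: ler_prod_seq => z _; rewrite nrm_ge0 /=.
apply: le_trans (nrmD_le _ _) _; rewrite nrmN nrm_of_creal //.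
have : c * 1 <= c * (2 * clipped_nrm z).
  by rewrite ler_wpM2l //; have := clipped_nrm_half z; lra.
by have := nrm_le_clipped z; lra.
Qed.

(** * Far critical points *)

Section FarCriticalPoints.
Variables (C : numClosedFieldType) (a : creal C) (zs s : seq C).
Local Notation R := (creal C).
Local Notation n := (size s).+1.
Local Notation p := (\prod_(z <- zs) ('X - z%:P)).
Local Notation crit := (\prod_(g <- s) ('X - g%:P)).
Hypotheses (a_gt0 : 0 < a) (a_lt1 : a < 1).
Hypothesis nrm_zs : {in zs, forall z, nrm z <= 1}.
Hypothesis lune_s : {in s, forall g, lune a g}.
Hypothesis size_zs : size zs = size s.
Hypothesis dP : (('X - a%:C%:P) * p)^`() = n%:R *: crit.
Implicit Types (w : C) (c e t x : R).

Let L : R := nrm crit.[a%:C].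

Lemma deriv_at_root_ge1 : 1 <= L.
Proof.
rewrite /L nrm_horner_prod_XsubC [leLHS](_ : 1 = \prod_(g <- s) 1); last by rewrite big1.
by apply: ler_prod_seq => g /lune_s/andP[_ ->]; rewrite ler01.
Qed.

Let L_gt0 : 0 < L. Proof. exact: lt_le_trans ltr01 deriv_at_root_ge1. Qed.

Lemma quotient_ge w x : w != a%:C -> 0 < x <= 1 -> 1 <= n%:R * x ->
  all (apollonius w a%:C (1 - x)) s -> L / 4 <= nrm p.[w].
Proof.
move=> wa /andP[x0 x1] nx Ds; have q01 : 0 <= 1 - x < 1 by lra.
have [u ux ->] := quotient_coincidence_root dP q01 wa Ds.
rewrite nrmM -/L ler_wpM2l ?(ltW L_gt0) // -div1r.
by apply: nrm_geom_sum_ge nx ux; rewrite (ltW x0).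
Qed.

Lemma quotient_le w x : w != a%:C -> 0 < x <= 1 ->
  all (apollonius w a%:C (1 - x)) s -> x * nrm p.[w] <= 2 * L.
Proof.
move=> wa /andP[x0 x1] Ds; have q01 : 0 <= 1 - x < 1 by lra.
have [u ux ->] := quotient_coincidence_root dP q01 wa Ds.
by rewrite nrmM -/L mulrCA mulrC ler_wpM2r ?(ltW L_gt0) // nrm_geom_sum_le // ltW.
Qed.

Lemma left_neq_root t : 0 < t -> (a - t)%:C != a%:C.
Proof. by move=> t0; rewrite (inj_eq (@of_creal_inj C)) lt_eqF // gtrBl. Qed.

Lemma left_apollonius t : 0 <= t <= a ->
  all (apollonius (a - t)%:C a%:C (1 - t * (a - t) / 2)) s.
Proof. by move=> t_a; apply/allP => g /lune_s lune_g; apply: lune_apollonius_left. Qed.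

Lemma quotient_left_ge t : 0 < t < a -> 1 <= n%:R * (t * (a - t) / 2) ->
  L / 4 <= nrm p.[(a - t)%:C].
Proof.
move=> /andP[t0 ta] nt; apply: quotient_ge nt (left_apollonius _); rewrite ?left_neq_root //.
  by move: a_lt1; nra.
by rewrite !ltW.
Qed.

Lemma quotient_right_ge e : 0 < e -> e * a <= 1 -> 1 <= n%:R * (e * a / 4) ->
  (L / 4) ^+ 2 * (1 + e * a) ^+ size s <= nrm p.[(a + e)%:C] ^+ 2.
Proof.
move=> e0 ea1 n_ea; have ea0 : 0 < e * a by rewrite mulr_gt0.
have e_neq : (a + e)%:C != a%:C by rewrite (inj_eq (@of_creal_inj C)) gt_eqF // ltrDl.
have q01 : 0 <= 1 - e * a / 4 < 1 by lra.
have [|u ux ->] := quotient_coincidence dP q01 e_neq.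
  by apply/allP => g /lune_s lune_g; apply: lune_apollonius_right; rewrite // ltW.
have geom : 1 / 4 <= nrm (\sum_(i < n) u ^+ i) by apply: nrm_geom_sum_ge n_ea ux; lra.
have growth : L ^+ 2 * (1 + e * a) ^+ size s <= nrm crit.[(a + e)%:C] ^+ 2.
  rewrite /L !nrm_horner_prod_XsubC -!prodrXl -prod_mulr_const.
  apply: ler_prod_seq => g /lune_s lune_g; rewrite mulr_ge0 ?sqr_ge0 ?addr_ge0 ?(ltW ea0) //=.
  by rewrite mulrC lune_growth // ltW.
have -> : (L / 4) ^+ 2 * (1 + e * a) ^+ size s = L ^+ 2 * (1 + e * a) ^+ size s * (1 / 4) ^+ 2.
  by field.
rewrite nrmM [leRHS]exprMn ler_pM ?sqr_ge0 //.
  by rewrite mulr_ge0 ?sqr_ge0 // exprn_ge0 // addr_ge0 // ltW.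
by rewrite lerXn2r ?nnegrE ?nrm_ge0 // divr_ge0.
Qed.

Lemma root_away_left e : 0 < e <= a / 4 -> 1 <= n%:R * (e * a / 8) ->
  {in zs, forall z, a * e / 4 <= nrm ((a - e)%:C - z)}.
Proof.
move=> /andP[e0 ea] n_ea z zz; rewrite leNgt; apply/negP => near.
have ea0 := mulr_gt0 e0 a_gt0.
have za : z != a%:C.
  apply: contraTneq near => ->; rewrite -leNgt -rmorphB addrAC subrr sub0r.
  by rewrite rmorphN /= nrmN nrm_of_creal ?(ltW e0) //; move: a_lt1; nra.
have pz0 : p.[z] = 0 by apply/rootP; rewrite root_prod_XsubC.
have : L / 4 <= nrm p.[z].
  apply: (quotient_ge za _ n_ea); first by move: a_lt1; nra.
  apply/allP => g /lune_s lune_g; apply: lune_apollonius_near_left => //.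
    by rewrite (ltW e0).
  by rewrite nrmBC ltW.
by rewrite pz0 nrm0 leNgt divr_gt0.
Qed.

Let W : R := \prod_(z <- zs) (clipped_nrm z)^-1.

Let W_ge0 : 0 <= W.
Proof. by rewrite prodr_ge0 // => z _; rewrite invr_ge0 ltW ?clipped_nrm_gt0. Qed.

(* The value of [p] at [4 / (n * a)] is at least [1 / 4], so that the roots cannot be too
   small on average. *)
Lemma prod_clippedV_le (K : nat) : 8 <= n%:R * a ^+ 2 -> 8 <= K%:R * a -> W <= 4 ^+ K.+1.
Proof.
move=> na2 Ka; have n0 : 0 < n%:R :> R by rewrite ltr0n.
pose c := 4 / a / n%:R; have c0 : 0 < c by rewrite !divr_gt0.
have cna : c * (n%:R * a) = 4 by rewrite /c; field; rewrite nat1r !gt_eqF.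
have ca : c <= a / 2 by rewrite -(ler_pM2r (mulr_gt0 n0 a_gt0)) cna; lra.
have p_c : 1 / 4 <= nrm p.[c%:C].
  apply: (@le_trans _ _ (L / 4)); first by rewrite ler_pM2r ?invr_gt0 // deriv_at_root_ge1.
  rewrite -[c](subKr a); apply: quotient_left_ge; first by lra.
  rewrite subKr; have nc0 : 0 <= n%:R * c by rewrite pmulr_rge0 // ltW.
  by have : 0 <= n%:R * c * (a / 2 - c) by [rewrite mulr_ge0 // subr_ge0]; lra.
have clipped0 : 0 <= \prod_(z <- zs) clipped_nrm z.
  by rewrite prodr_ge0 // => z _; rewrite ltW ?clipped_nrm_gt0.
have pow_le : (1 + 2 * c) ^+ size zs <= 4 ^+ K.
  apply: (@le_trans _ _ ((1 + 2 * c) ^+ n)).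
    by rewrite size_zs ler_weXn2l // lerDl mulr_ge0 // ltW.
  have -> : 2 * c = 8 / a / n%:R by rewrite /c; field; rewrite nat1r !gt_eqF.
  by apply: expr_1D_div_le_4X; rewrite // divr_ge0 ?(ltW a_gt0) // ler_pdivrMr.
have prod_ge : 1 / 4 <= (\prod_(z <- zs) clipped_nrm z) * 4 ^+ K.
  apply: le_trans p_c _; rewrite nrm_horner_prod_XsubC.
  by apply: le_trans (prod_nrm_le_clipped _ (ltW c0)) _; rewrite ler_wpM2l.
have WE : W * \prod_(z <- zs) clipped_nrm z = 1.
  by rewrite /W -big_split big1 //= => z _; rewrite mulVf // gt_eqF ?clipped_nrm_gt0.
have := ler_wpM2l W_ge0 prod_ge; rewrite [leRHS]mulrA WE mul1r exprS.
by move: (4 ^+ K) => X; lra.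
Qed.

Let Q c : C := \prod_(z <- zs) reflected z c.

Lemma quotient_le_reflected c : 0 <= c <= 1 -> nrm p.[c%:C] <= nrm (Q c).
Proof.
move=> c01; rewrite nrm_horner_prod_XsubC nrm_prod; apply: ler_prod_seq => z zz.
by rewrite nrm_ge0 nrm_le_reflected ?nrm_zs.
Qed.

Lemma prod_reflected_midpoint c t y : 0 <= c <= a -> 0 <= t -> 0 <= y ->
  t ^+ 2 <= y * (1 - a) ^+ 2 ->
  nrm (Q (c + t)) * nrm (Q (c - t)) <= nrm (Q c) ^+ 2 * (1 + y) ^+ size s.
Proof.
move=> /andP[c0 ca] t0 y0 ty.
rewrite !nrm_prod -big_split -prodrXl -size_zs -prod_mulr_const /=.
apply: ler_prod_seq => z zz; rewrite mulr_ge0 ?nrm_ge0 //=.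
apply: nrm_reflected_midpoint; rewrite ?nrm_zs ?c0 //=; first exact: le_trans (ltW a_lt1).
apply: le_trans ty _; rewrite ler_wpM2l // lerXn2r ?nnegrE ?subr_ge0 ?(ltW a_lt1) //.
  exact: le_trans (ltW a_lt1).
by rewrite lerD2l lerN2.
Qed.

Lemma prod_reflected_le c (T k : nat) : 0 <= c <= a -> 2 <= T%:R * (1 - a) -> (8 <= k)%N ->
  {in zs, forall z, 4 <= 2 ^+ k * nrm (c%:C - z) ^+ 2} ->
  nrm (Q c) ^+ 2 <= nrm p.[c%:C] ^+ 2 * W ^+ (T * k).
Proof.
move=> ca Ta k_ge8 far; rewrite nrm_horner_prod_XsubC nrm_prod /W -!prodrXl -big_split /=.
apply: ler_prod_seq => z zz; rewrite sqr_ge0 /=.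
exact: (sqr_nrm_reflected_le (nrm_zs zz) ca a_lt1 Ta k_ge8 (far z zz)).
Qed.

Section ThreePoints.
Variable e : R.
Hypotheses (e_gt0 : 0 < e) (e_le_root : e <= a / 9) (e_le_gap : e <= (1 - a) / 9).
Hypothesis n_ea : 72 <= n%:R * (e * a).

Let ea_gt0 : 0 < e * a. Proof. exact: mulr_gt0. Qed.

Lemma increment_mul_root_le : e * a <= 1 / 9.
Proof.
apply: (@le_trans _ _ (e * 1)); first by rewrite ler_wpM2l ?(ltW e_gt0) ?(ltW a_lt1).
by move: a_gt0 e_le_gap; lra.
Qed.

Lemma reflected_three_points : (3 / 2 * e) ^+ 2 = e * a / 4 * (1 - a) ^+ 2 ->
  nrm (Q (a + e)) * nrm (Q (a - 2 * e)) <=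
  nrm (Q (a - e / 2)) ^+ 2 * (1 + e * a / 4) ^+ size s.
Proof.
move=> e_mid.
have -> : a + e = a - e / 2 + 3 / 2 * e by field.
have -> : a - 2 * e = a - e / 2 - 3 / 2 * e by field.
apply: prod_reflected_midpoint; last by rewrite e_mid.
- by move: e_gt0 e_le_root; lra.
- by rewrite mulr_ge0 ?divr_ge0 ?(ltW e_gt0).
- by rewrite divr_ge0 ?(ltW ea_gt0).
Qed.

Lemma reflected_forward_ge :
  (L / 4) ^+ 2 * (1 + e * a) ^+ size s <= nrm (Q (a + e)) ^+ 2.
Proof.
apply: (@le_trans _ _ (nrm p.[(a + e)%:C] ^+ 2)).
  by apply: quotient_right_ge => //; move: n_ea increment_mul_root_le; lra.
rewrite lerXn2r ?nnegrE ?nrm_ge0 // quotient_le_reflected //.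
by move: a_gt0 a_lt1 e_gt0 e_le_gap; lra.
Qed.

Lemma reflected_backward_ge : L / 4 <= nrm (Q (a - 2 * e)).
Proof.
apply: (@le_trans _ _ (nrm p.[(a - 2 * e)%:C])); last first.
  by apply: quotient_le_reflected; move: a_lt1 e_gt0 e_le_root; lra.
apply: quotient_left_ge; first by move: e_gt0 e_le_root; lra.
have : 0 <= n%:R * e * (a / 9 - e) by rewrite !mulr_ge0 ?subr_ge0 ?(ltW e_gt0).
by move: n_ea; lra.
Qed.

Lemma quotient_centre_le V : 256 <= V * (e * a) ^+ 2 ->
  nrm p.[(a - e / 2)%:C] ^+ 2 <= L ^+ 2 * V.
Proof.
move=> V_ge; pose x := e / 2 * (a - e / 2) / 2.
have x_ge : e * a / 8 <= x.
  have : 0 <= e * (a / 9 - e) by rewrite mulr_ge0 ?subr_ge0 ?(ltW e_gt0).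
  by rewrite /x; move: ea_gt0; lra.
have x01 : 0 < x <= 1.
  rewrite (lt_le_trans _ x_ge) ?divr_gt0 //= /x.
  by move: e_gt0 e_le_root a_lt1; nra.
have half_e : 0 < e / 2 by rewrite divr_gt0.
have e_in : 0 <= e / 2 <= a by move: e_gt0 e_le_root; lra.
have := quotient_le (left_neq_root half_e) x01 (left_apollonius e_in).
move: (nrm _) (nrm_ge0 p.[(a - e / 2)%:C]) => P P0 xP.
have eaP : e * a * P <= 16 * L.
  have : e * a / 8 * P <= x * P by rewrite ler_wpM2r.
  by move: xP; lra.
have eaP2 : (e * a * P) ^+ 2 <= (16 * L) ^+ 2.
  by rewrite lerXn2r ?nnegrE ?mulr_ge0 // ltW.
rewrite -(ler_pM2r (exprn_gt0 2 ea_gt0)).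
have : 0 <= L ^+ 2 * (V * (e * a) ^+ 2 - 256) by rewrite mulr_ge0 ?sqr_ge0 ?subr_ge0.
by move: eaP2; lra.
Qed.

Lemma reflected_centre_le (K T k : nat) : 8 <= K%:R * a -> 2 <= T%:R * (1 - a) ->
  (8 <= k)%N -> 256 <= 2 ^+ k * (e * a) ^+ 2 ->
  nrm (Q (a - e / 2)) ^+ 2 <= L ^+ 2 * 2 ^+ (k + 2 * (K.+1 * (T * k))).
Proof.
move=> Ka Ta k_ge8 k_large.
have half_e : 0 < e / 2 <= a / 4 by move: e_gt0 e_le_root; lra.
have away : {in zs, forall z, 4 <= 2 ^+ k * nrm ((a - e / 2)%:C - z) ^+ 2}.
  move=> z zz; have mass : 1 <= n%:R * (e / 2 * a / 8) by move: n_ea; lra.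
  have far := root_away_left half_e mass zz.
  apply: (@le_trans _ _ (2 ^+ k * (a * (e / 2) / 4) ^+ 2)); first by move: k_large; lra.
  rewrite ler_wpM2l ?exprn_ge0 // lerXn2r ?nnegrE ?nrm_ge0 //.
  by move: ea_gt0; lra.
have centre_in : 0 <= a - e / 2 <= a by move: e_gt0 e_le_root; lra.
have na2 : 8 <= n%:R * a ^+ 2.
  apply: (@le_trans _ _ (n%:R * (e * a))); first by move: n_ea; lra.
  by rewrite ler_wpM2l // expr2 ler_wpM2r ?(ltW a_gt0) //; move: e_le_root a_gt0; lra.
have W_le : W <= 2 ^+ (2 * K.+1).
  by rewrite exprM (_ : 2 ^+ 2 = 4 :> R); [exact: prod_clippedV_le | ring].
apply: le_trans (prod_reflected_le centre_in Ta k_ge8 away) _.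
rewrite exprD mulrA (mulnA 2%N) (exprM _ (2 * _)) ler_pM ?sqr_ge0 ?exprn_ge0 ?quotient_centre_le //.
by rewrite lerXn2r ?nnegrE ?exprn_ge0.
Qed.

End ThreePoints.

Theorem far_critical_points_degree_lt : a ^+ 7 * (1 - a) ^+ 4 * n%:R < 144 ^+ 2.
Proof.
rewrite ltNge; apply/negP => n_large.
have [K [T [k [J [Ka Ta [k_ge8 k_large] J_large Jm]]]]] := ex_exponents a_gt0 a_lt1 n_large.
have := step_scales (degree_mass_ge a_gt0 a_lt1 (i := 2) n_large isT) k_large J_large.
have := step_midpoint a; have := step_le_gap a_gt0 a_lt1.
have := step_le_root a_gt0 a_lt1; have := step_gt0 a_gt0 a_lt1.
move: (step a) => e e_gt0 e_le_root e_le_gap e_mid [n_ea V_ge Jd].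
have ea_gt0 := mulr_gt0 e_gt0 a_gt0.
have ea01 : 0 <= e * a <= 1 / 9 by rewrite (ltW ea_gt0) increment_mul_root_le.
have centre := reflected_centre_le e_gt0 e_le_root n_ea Ka Ta k_ge8 V_ge.
have := three_point_growth_le L_gt0 ea01 (nrm_ge0 _) (reflected_forward_ge e_gt0 e_le_gap n_ea)
  (reflected_backward_ge e_gt0 e_le_root n_ea) _ (reflected_three_points e_gt0 e_le_root e_mid).
rewrite sqr_ge0 => /(_ _ centre); apply/negP; rewrite -ltNge.
by apply: dyadic_lt_growth Jd Jm; rewrite mulr_ge0 ?divr_ge0 ?(ltW ea_gt0).
Qed.

End FarCriticalPoints.

(** * Sendov's conjecture in large degree *)

Lemma deriv_monic_factor (C : numClosedFieldType) (P : {poly C}) m :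
  P \is monic -> size P = m.+2 ->
  exists2 s, size s = m & P^`() = m.+1%:R *: \prod_(g <- s) ('X - g%:P).
Proof.
move=> /monicP lead_P size_P.
have coef_top : P^`()`_m = m.+1%:R by rewrite coef_deriv -[in RHS]lead_P /lead_coef size_P.
have size_dP : size P^`() = m.+1.
  apply/eqP; rewrite eqn_leq -ltnS -size_P lt_size_deriv -?size_poly_eq0 ?size_P //=.
  by rewrite ltnNge; apply/negP => /(nth_default 0)/eqP; rewrite coef_top pnatr_eq0.
have [s dP_split] := closed_field_poly_normal P^`().
have lead_dP : lead_coef P^`() = m.+1%:R by rewrite /lead_coef size_dP.
exists s; last by rewrite {1}dP_split lead_dP.
by apply: eq_add_S; rewrite -size_dP dP_split size_scale ?lead_dP ?pnatr_eq0 // size_prod_XsubC.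
Qed.

Theorem critical_point_near_root (C : numClosedFieldType) (a : creal C) (zs : seq C) :
  0 < a -> a < 1 -> {in zs, forall z, nrm z <= 1} ->
  144 ^+ 2 <= a ^+ 7 * (1 - a) ^+ 4 * (size zs).+1%:R ->
  exists2 w, root (('X - a%:C%:P) * \prod_(z <- zs) ('X - z%:P))^`() w & nrm (w - a%:C) <= 1.
Proof.
move=> a_gt0 a_lt1 nrm_zs n_large; set P := _ * _.
have PE : P = \prod_(z <- a%:C :: zs) ('X - z%:P) by rewrite big_cons.
have [s ss dP] : exists2 s, size s = size zs &
    P^`() = (size zs).+1%:R *: \prod_(g <- s) ('X - g%:P).
  by apply: deriv_monic_factor; rewrite PE ?monic_prod_XsubC // size_prod_XsubC.
have rootP' w : root P^`() w = (w \in s).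
  by rewrite dP rootZ ?pnatr_eq0 // root_prod_XsubC.
have [/hasP[w ws wa]|/hasPn far] := boolP (has (fun w => nrm (w - a%:C) <= 1) s).
  by exists w; rewrite ?rootP'.
move: n_large; rewrite leNgt -ss => /negP[].
apply: (@far_critical_points_degree_lt C a zs s); rewrite ?ss // => g gs.
apply/andP; split; last by rewrite nrmBC ltW // ltNge far.
apply: (@gauss_lucas C 1 (a%:C :: zs)); rewrite // -?PE ?rootP' // => z.
by rewrite inE => /predU1P[->|/nrm_zs //]; rewrite nrm_of_creal ltW.
Qed.

Theorem mainTheorem1 (C : numClosedFieldType) (a : C)
  (ha_real : a \is Num.real) (ha0 : 0 < a) (ha1 : a < 1)
  (n : nat) (hn : calN a <= n%:R)
  (z : 'I_n.-1 -> C) (hz : forall j, `|z j| <= 1) :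
  exists w : C, root (sendovP a z)^`() w /\ `|w - a| <= 1.
Proof.
pose r : creal C := Sub a ha_real.
have weight_gt0 : 0 < a ^+ 7 * (1 - a) ^+ 4 by rewrite mulr_gt0 ?exprn_gt0 ?subr_gt0.
have n_gt0 : (0 < n)%N.
  by rewrite -(ltr0n C); apply: lt_le_trans hn; rewrite divr_gt0 ?ltr0n.
have nrm_le1 (x : C) : (nrm x <= 1) = (`|x| <= 1) by rewrite -ler_of_creal rmorph1.
pose zs := [seq z j | j <- enum 'I_n.-1].
have size_zs : (size zs).+1 = n by rewrite size_map size_enum_ord prednK.
have PE : sendovP a z = ('X - r%:C%:P) * \prod_(w <- zs) ('X - w%:P).
  by rewrite /sendovP /zs big_map big_enum.
have [||||w] := @critical_point_near_root C r zs.
- exact: ha0.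
- exact: ha1.
- by move=> _ /mapP[j _ ->]; rewrite nrm_le1.
- rewrite size_zs -ler_of_creal !(rmorphM, rmorphXn, rmorphB, rmorph1, rmorph_nat) /=.
  move: hn; rewrite ler_pdivrMr // mulrC; apply: le_trans.
  by rewrite -expr2 -natrX ler_nat; vm_compute.
by rewrite -PE nrm_le1; exists w.
Qed.
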